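(* Suppose $\psi$ is an analytic function on $\mathbb{D}$ inducing a bounded multiplication operator $M_\psi$ on the Bloch space $\mathcal{B}$. Then $$\max\left\{\|\psi\|_{\mathcal{B}},\|\psi\|_\infty\right\} \leq \|M_\psi\| \leq \max\left\{\|\psi\|_{\mathcal{B}},\ \|\psi\|_\infty + \sigma_\psi^\infty\right\}.$$ In particular, if $\psi(0)=0$, then $$\|\psi\|_\infty \leq \|M_\psi\| \leq \|\psi\|_\infty + \sigma_\psi^\infty.$$
   Context: $\mathbb{D}$ is the open unit disk in $\mathbb{C}$. For $f$ analytic on $\mathbb{D}$, put $\beta_f = \sup_{z\in\mathbb{D}} (1-|z|^2)|f'(z)|$. The Bloch space $\mathcal{B}$ is the complex Banach space of analytic functions $f$ on $\mathbb{D}$ with $\beta_f<\infty$, with norm $\|f\|_{\mathcal{B}} = |f(0)|+\beta_f$. The multiplication operator is $M_\psi(f)=\psi f$; it is bounded on $\mathcal{B}$ if it is a bounded linear operator from $\mathcal{B}$ to $\mathcal{B}$, and $\|M_\psi\|$ denotes its operator norm. $\|\psi\|_\infty=\sup_{z\in\mathbb{D}}|\psi(z)|$, and $$\sigma_\psi^\infty = \sup_{z\in\mathbb{D}}\frac12(1-|z|^2)|\psi'(z)|\log\frac{1+|z|}{1-|z|}.$$ By known results, when $M_\psi$ is bounded on $\mathcal{B}$, one has $\psi\in\mathcal{B}$, $\|\psi\|_\infty<\infty$ and $\sigma_\psi^\infty<\infty$. *)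

(* Defs.v *)
From Stdlib Require Export Reals.
From Coquelicot Require Export Coquelicot.
Open Scope R_scope.

(* Functions on the open unit disk are represented by total functions C -> C;
   every notion below depends only on their values on the disk. *)
Definition in_disk (z : C) : Prop := Cmod z < 1.

Definition analytic_at (f : C -> C) (z : C) : Prop :=
  exists (a : nat -> C) (r : R), 0 < r /\
    forall w : C, Cmod (w - z)%C < r ->
      @is_pseries C_AbsRing C_NormedModule a (w - z)%C (f w).

Definition analytic_on_disk (f : C -> C) : Prop :=
  forall z : C, in_disk z -> analytic_at f z.

(* Suprema are taken in the extended reals, so infinite values are kept. *)
Definition disk_sup (u : C -> R) : Rbar :=
  Lub_Rbar (fun x : R => exists z : C, in_disk z /\ x = u z).

(* [C_derive f z] is a total operator whose value is the complex derivative
   wherever it exists, hence on the whole disk when [f] is analytic there. *)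
Definition bloch_beta (f : C -> C) : Rbar :=
  disk_sup (fun z => (1 - Cmod z ^ 2) * Cmod (C_derive f z)).

Definition bloch (f : C -> C) : Prop :=
  analytic_on_disk f /\ Rbar_lt (bloch_beta f) p_infty.

Definition bloch_norm (f : C -> C) : Rbar :=
  Rbar_plus (Finite (Cmod (f (RtoC 0)))) (bloch_beta f).

Definition sup_norm (f : C -> C) : Rbar := disk_sup (fun z => Cmod (f z)).

Definition sigma_infty (f : C -> C) : Rbar :=
  disk_sup (fun z => / 2 * (1 - Cmod z ^ 2) * Cmod (C_derive f z)
                     * ln ((1 + Cmod z) / (1 - Cmod z))).

Definition mult_op (psi : C -> C) (f : C -> C) : C -> C :=
  fun z => (psi z * f z)%C.

(* Elements of the Bloch space are identified when they agree on the disk,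
   so linearity is stated pointwise there. *)
Definition bloch_bounded_operator (T : (C -> C) -> (C -> C)) : Prop :=
  (forall f, bloch f -> bloch (T f)) /\
  (forall f g, bloch f -> bloch g -> forall z, in_disk z ->
     T (fun w => (f w + g w)%C) z = (T f z + T g z)%C) /\
  (forall (c : C) f, bloch f -> forall z, in_disk z ->
     T (fun w => (c * f w)%C) z = (c * T f z)%C) /\
  (exists M : R, forall f, bloch f ->
     Rbar_le (bloch_norm (T f)) (Rbar_mult (Finite M) (bloch_norm f))).

Definition bloch_op_norm (T : (C -> C) -> (C -> C)) : Rbar :=
  Rbar_lub (fun y : Rbar => exists f : C -> C,
    bloch f /\ Rbar_le (bloch_norm f) (Finite 1) /\ y = bloch_norm (T f)).

Definition Rbar_max (x y : Rbar) : Rbar :=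
  if Rbar_le_dec x y then y else x.

(* Main.v *)
Require Import Defs.
From Stdlib Require Import Lra Psatz Classical ClassicalEpsilon.
From Stdlib Require Import FunctionalExtensionality.

(** Write ||.|| for the Bloch norm, and L(z) for half the logarithm of
    (1 + |z|) / (1 - |z|), so that L is the integral of 1 / (1 - t^2) from 0
    to |z|.  Integrating f' along the radius gives the growth estimate
    |f(z)| <= |f(0)| + beta_f L(z) ([bloch_growth]), which is behind both the
    bound of sup |psi| and the upper bound.

    The operator norm dominates ||psi|| because the constant 1 has norm 1 and
    is sent to psi.  It dominates sup |psi| by a power trick
    ([sup_norm_le_op_norm]): psi^n is the n-th iterate of the operator applied
    to 1, so ||psi^n|| <= N^n with N the operator norm; evaluating at z costs
    only a factor 1 + L(z) that does not depend on n, and n-th roots remove it.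

    For the upper bound ([bloch_norm_mult_le]), the product rule and the growth
    estimate bound ||psi f|| by
    ||psi|| |f(0)| + (sup |psi| + sigma) beta_f, a combination of the two
    members of the maximum with weights |f(0)| and beta_f of sum at most 1.

    When psi(0) = 0 the maximum is its second member, because then
    ||psi|| = beta_psi <= sup |psi|.  This is the Schwarz-Pick inequality
    ([schwarz_pick]): the quotient of (psi(z) - psi(a)) / (M^2 - conj(psi(a))
    psi(z)) by the corresponding Blaschke factor at a is bounded on circles,
    and the maximum principle carries the bound to the point a.

    Since analyticity means local power series, the maximum principle is
    obtained from second-order expansions alone ([quad_at]).  This class of
    functions is visibly stable under products and inverses, and averaging such
    an expansion over the four points p + i^k t cancels its linear and quadratic
    terms, so that |h|^2 + eps |z|^2 has no interior maximum
    ([no_interior_max]). *)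

(** * Local expansions *)

Definition near (p : C) (P : C -> Prop) : Prop :=
  exists d : R, 0 < d /\ forall z : C, Cmod (z - p) < d -> P z.

Lemma near_and (p : C) (P Q : C -> Prop) :
  near p P -> near p Q -> near p (fun z => P z /\ Q z).
Proof.
intros [d [Hd HP]] [e [He HQ]].
exists (Rmin d e); split; [now apply Rmin_pos|].
intros z Hz; split.
- apply HP; apply Rlt_le_trans with (1 := Hz), Rmin_l.
- apply HQ; apply Rlt_le_trans with (1 := Hz), Rmin_r.
Qed.

Lemma near_imp (p : C) (P Q : C -> Prop) :
  (forall z, P z -> Q z) -> near p P -> near p Q.
Proof. intros H [d [Hd HP]]; exists d; split; auto. Qed.

Lemma Cmod_le_sub (z p : C) : Cmod p <= Cmod z + Cmod (z - p).
Proof.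
rewrite <- (Cmod_opp (z - p)).
replace p with (z + - (z - p))%C at 1 by ring; apply Cmod_triangle.
Qed.

(** The uniform structure is the one of the modulus rather than that of the
    product of two lines, so that the continuity of sums and products is an
    instance of the statements on rings with an absolute value. *)
Definition cont_at (f : C -> C) (p : C) : Prop :=
  @continuous (AbsRing_UniformSpace C_AbsRing)
              (AbsRing_UniformSpace C_AbsRing) f p.

Lemma cont_at_iff (f : C -> C) (p : C) :
  cont_at f p <->
  forall eps : R, 0 < eps -> near p (fun z => Cmod (f z - f p) < eps).
Proof.
unfold cont_at, continuous; rewrite filterlim_locally; split.
- intros H eps Heps; destruct (H (mkposreal eps Heps)) as [d Hd].
  exists d; split; [apply cond_pos|]; intros z Hz; exact (Hd z Hz).
- intros H eps; destruct (H eps (cond_pos eps)) as [d [Hd Hz]].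
  exists (mkposreal d Hd); exact Hz.
Qed.

Lemma cont_at_const (c p : C) : cont_at (fun _ => c) p.
Proof.
exact (@continuous_const (AbsRing_UniformSpace C_AbsRing)
         (AbsRing_UniformSpace C_AbsRing) c p).
Qed.

Lemma cont_at_id (p : C) : cont_at (fun z => z) p.
Proof. exact (@continuous_id (AbsRing_UniformSpace C_AbsRing) p). Qed.

Lemma cont_at_plus (f g : C -> C) (p : C) :
  cont_at f p -> cont_at g p -> cont_at (fun z => f z + g z)%C p.
Proof.
exact (@continuous_plus (AbsRing_UniformSpace C_AbsRing) C_AbsRing
         (AbsRing_NormedModule C_AbsRing) f g p).
Qed.

Lemma cont_at_mult (f g : C -> C) (p : C) :
  cont_at f p -> cont_at g p -> cont_at (fun z => f z * g z)%C p.
Proof.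
exact (@continuous_mult (AbsRing_UniformSpace C_AbsRing) C_AbsRing f g p).
Qed.

Lemma cont_at_inv (f : C -> C) (p : C) :
  cont_at f p -> f p <> 0%C -> cont_at (fun z => / f z)%C p.
Proof.
rewrite !cont_at_iff; intros Hf Hp eps Heps.
assert (Hm : 0 < Cmod (f p)) by now apply Cmod_gt_0.
set (m := Cmod (f p)) in *.
assert (He : 0 < Rmin (m / 2) (eps * (m * m) / 2)).
{ apply Rmin_pos; [lra|]. assert (0 < m * m) by nra. nra. }
apply near_imp with (2 := Hf _ He); intros z Hz.
assert (Hz1 := Rlt_le_trans _ _ _ Hz (Rmin_l _ _)).
assert (Hz2 := Rlt_le_trans _ _ _ Hz (Rmin_r _ _)).
assert (Hlow : m / 2 < Cmod (f z)).
{ assert (T := Cmod_le_sub (f z) (f p)); fold m in T; lra. }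
assert (Hnz : f z <> 0%C) by (apply Cmod_gt_0; lra).
replace (/ f z - / f p)%C with (- (f z - f p) / (f z * f p))%C
  by (field; now split).
rewrite Cmod_div, Cmod_opp, Cmod_mult by now apply Cmult_neq_0.
fold m; apply Rlt_div_l; [nra|].
apply Rlt_le_trans with (1 := Hz2).
assert (0 < eps * m) by nra; nra.
Qed.

Lemma cont_at_shift (p : C) : cont_at (fun z => z - p)%C p.
Proof. apply cont_at_plus; [apply cont_at_id|apply cont_at_const]. Qed.

Ltac cont_at_tac :=
  lazymatch goal with
  | |- cont_at (fun _ => ?c) _ => apply cont_at_const
  | |- cont_at (fun z => Cplus (@?f z) (@?g z)) _ =>
      apply (cont_at_plus f g); cont_at_tac
  | |- cont_at (fun z => Cmult (@?f z) (@?g z)) _ =>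
      apply (cont_at_mult f g); cont_at_tac
  | |- cont_at (fun z => Cminus z ?p) ?p => apply cont_at_shift
  | |- cont_at (fun z => Cinv (@?f z)) _ => apply (cont_at_inv f); cont_at_tac
  | |- _ => assumption
  end.

Lemma cont_at_near_ne (f : C -> C) (p : C) :
  cont_at f p -> f p <> 0%C -> near p (fun z => f z <> 0%C).
Proof.
rewrite cont_at_iff; intros Hf Hp; apply Cmod_gt_0 in Hp.
apply near_imp with (2 := Hf _ Hp); intros z Hz E.
rewrite E in Hz; unfold Cminus in Hz; rewrite Cplus_0_l, Cmod_opp in Hz; lra.
Qed.

Lemma Cminus_ne (z p : C) : z <> p -> (z - p <> 0)%C.
Proof. intros H E; apply H, Ceq_minus, E. Qed.

(** The value [d] at [p] is a parameter: the derivative is the value which makes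
    the slope function analytic at [p]. *)
Definition slope (f : C -> C) (p d z : C) : C :=
  if excluded_middle_informative (z = p) then d else ((f z - f p) / (z - p))%C.

Lemma slope_eq (f : C -> C) (p d z : C) :
  f z = (f p + (z - p) * slope f p d z)%C.
Proof.
unfold slope; destruct (excluded_middle_informative _) as [->|Hz]; [ring|].
field; now apply Cminus_ne.
Qed.

Lemma slope_center (f : C -> C) (p d : C) : slope f p d p = d.
Proof. now unfold slope; destruct (excluded_middle_informative _). Qed.

(** The terms at radius r / 2 are bounded, being those of a convergent series,
    so at radius r / 4 the series is dominated by a geometric one. *)
Lemma pseries_bounded (a : nat -> C) (r : R) (g : C -> C) :
  0 < r ->
  (forall w : C, Cmod w < r -> @is_pseries C_AbsRing C_NormedModule a w (g w)) ->
  exists K d : R, 0 < d /\ forall w : C, Cmod w < d -> Cmod (g w) <= K.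
Proof.
intros Hr Hg.
set (rho := RtoC (r / 2)).
assert (Hrho : Cmod rho = r / 2).
{ unfold rho; rewrite Cmod_R; apply Rabs_pos_eq; lra. }
assert (Hrho0 : Cmod rho < r) by lra.
pose (t := fun w n => @scal C_AbsRing C_NormedModule (pow_n w n) (a n)).
destruct (@filterlim_bounded C_AbsRing C_NormedModule (sum_n (t rho)))
  as [K HK].
{ exists (g rho); exact (Hg rho Hrho0). }
assert (Hmod : forall w n, Cmod (t w n) = Cmod w ^ n * Cmod (a n)).
{ intros w n; unfold t; change scal with Cmult.
  rewrite Cmod_mult; f_equal; induction n as [|n IH].
  - apply Cmod_1.
  - simpl; change (@mult C_Ring) with Cmult; now rewrite Cmod_mult, IH. }
(* Each term is the difference of two partial sums of modulus at most K. *)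
assert (Hterm : forall n, (r / 2) ^ n * Cmod (a n) <= 2 * K).
{ intros n; rewrite <- Hrho, <- Hmod; destruct n as [|n].
  - assert (H0 := HK 0%nat); rewrite sum_O in H0.
    change (Cmod (t rho 0%nat) <= K) in H0.
    generalize (Cmod_ge_0 (t rho 0%nat)); lra.
  - assert (H1 := HK (S n)); assert (H0 := HK n).
    rewrite sum_Sn in H1.
    assert (T : forall s u : C, Cmod u <= Cmod (s + u) + Cmod s).
    { intros s u; rewrite <- (Cmod_opp s).
      replace u with (s + u + - s)%C at 1 by ring; apply Cmod_triangle. }
    apply Rle_trans with (1 := T (sum_n (t rho) n) (t rho (S n))).
    apply Rle_trans with (1 := Rplus_le_compat _ _ _ _ H1 H0); lra. }
assert (HK0 : 0 <= K).
{ generalize (HK 0%nat) (norm_ge_0 (sum_n (t rho) 0%nat)); lra. }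
exists (4 * K), (r / 4); split; [lra|]; intros w Hw.
assert (Hsum : forall n, norm (sum_n (t w) n) <= 4 * K).
{ intros n; apply Rle_trans with (1 := norm_sum_n_m (t w) 0 n).
  apply Rle_trans with (4 * K * (1 - (1 / 2) ^ S n)).
  2: { assert (0 <= (1 / 2) ^ S n) by (apply pow_le; lra); nra. }
  assert (Hb : forall k, norm (t w k) <= 2 * K * (1 / 2) ^ k).
  { intros k; change (Cmod (t w k) <= 2 * K * (1 / 2) ^ k); rewrite Hmod.
    apply Rle_trans with ((r / 2) ^ k * Cmod (a k) * (1 / 2) ^ k).
    - apply Rle_trans with ((r / 4) ^ k * Cmod (a k)).
      + apply Rmult_le_compat_r; [apply Cmod_ge_0|].
        apply pow_incr; split; [apply Cmod_ge_0|lra].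
      + apply Req_le.
        replace (r / 4) with (r / 2 * (1 / 2)) by field.
        rewrite Rpow_mult_distr; ring.
    - apply Rmult_le_compat_r; [apply pow_le; lra|apply Hterm]. }
  change (sum_n (fun k => norm (t w k)) n <= 4 * K * (1 - (1 / 2) ^ S n)).
  induction n as [|n IH].
  - rewrite sum_O; apply Rle_trans with (1 := Hb _); simpl; lra.
  - rewrite sum_Sn; change plus with Rplus.
    apply Rle_trans with (1 := Rplus_le_compat _ _ _ _ IH (Hb _)).
    simpl; lra. }
assert (Hlim : is_lim_seq (fun n => norm (sum_n (t w) n)) (Cmod (g w))).
{ apply filterlim_comp with (2 := filterlim_norm (g w)).
  apply Hg; lra. }
exact (is_lim_seq_le _ _ _ _ Hsum Hlim (is_lim_seq_const _)).
Qed.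

Lemma analytic_at_bounded (f : C -> C) (p : C) :
  analytic_at f p -> exists K : R, near p (fun z => Cmod (f z) <= K).
Proof.
intros [a [r [Hr Hf]]].
destruct (pseries_bounded a r (fun w => f (w + p)%C) Hr) as [K [d [Hd HK]]].
{ intros w Hw; replace w with (w + p - p)%C at 1 by ring; apply Hf.
  now replace (w + p - p)%C with w by ring. }
exists K, d; split; [exact Hd|]; intros z Hz.
replace z with (z - p + p)%C by ring; now apply HK.
Qed.

(** Dropping the constant coefficient and dividing by the variable shifts the
    power series.  At the center the shifted series gives its first coefficient,
    hence the choice of [d]. *)
Lemma analytic_at_slope (f : C -> C) (p : C) :
  analytic_at f p -> exists d : C, analytic_at (slope f p d) p.
Proof.
intros [a [r [Hr Hf]]].
assert (Hp : f p = a 0%nat).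
{ assert (H0 : is_pseries a (p - p)%C (f p)).
  { apply Hf; replace (p - p)%C with (RtoC 0) by ring; now rewrite Cmod_0. }
  replace (p - p)%C with (RtoC 0) in H0 by ring.
  exact (filterlim_locally_unique _ _ _ H0 (is_pseries_0 a)). }
exists (a 1%nat), (PS_decr_1 a), r; split; [exact Hr|]; intros w Hw.
unfold slope; destruct (excluded_middle_informative (w = p)) as [->|Hne].
- replace (p - p)%C with (RtoC 0) by ring.
  exact (is_pseries_0 (PS_decr_1 a)).
- rewrite Hp; unfold Cdiv; rewrite Cmult_comm.
  apply (@is_pseries_decr_1 C_AbsRing C_NormedModule a (w - p)%C (/ (w - p))%C).
  + exact (Cinv_l _ (Cminus_ne _ _ Hne)).
  + now apply Hf.
Qed.

Lemma cont_at_of_bounded_slope (f : C -> C) (p d : C) (K : R) :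
  near p (fun z => Cmod (slope f p d z) <= K) -> cont_at f p.
Proof.
intros H; apply cont_at_iff; intros eps Heps.
assert (HK : 0 < Rmax K 1) by (apply Rlt_le_trans with (2 := Rmax_r _ _); lra).
assert (Hn : near p (fun z => Cmod (z - p) < eps / Rmax K 1)).
{ exists (eps / Rmax K 1); split; [|easy].
  now apply Rdiv_lt_0_compat. }
apply near_imp with (2 := near_and _ _ _ H Hn); intros z [H1 H2].
rewrite (slope_eq f p d z).
replace (f p + (z - p) * slope f p d z - f p)%C
  with ((z - p) * slope f p d z)%C by ring.
rewrite Cmod_mult.
apply Rle_lt_trans with (Cmod (z - p) * Rmax K 1).
- apply Rmult_le_compat_l; [apply Cmod_ge_0|].
  apply Rle_trans with (1 := H1), Rmax_l.
- now apply Rlt_div_r.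
Qed.

Lemma analytic_at_cont (f : C -> C) (p : C) : analytic_at f p -> cont_at f p.
Proof.
intros Hf; destruct (analytic_at_slope f p Hf) as [d Hd].
destruct (analytic_at_bounded _ _ Hd) as [K HK].
exact (cont_at_of_bounded_slope f p d K HK).
Qed.

(** Second-order expansion with continuous remainder, in the manner of
    Caratheodory: [b] is the derivative, and [l p] half the second derivative.
    Unlike a Taylor expansion with a little-o term, this form reduces the
    stability under products and inverses to polynomial identities. *)
Definition quad_at (f : C -> C) (p b : C) : Prop :=
  exists l : C -> C, cont_at l p /\
    near p (fun z => f z = (f p + b * (z - p) + (z - p) ^ 2 * l z)%C).

Lemma quad_at_ext (f g : C -> C) (p b : C) :
  near p (fun z => f z = g z) -> quad_at f p b -> quad_at g p b.
Proof.
intros Hfg [l [Hl Hf]]; exists l; split; [exact Hl|].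
assert (Hp : f p = g p).
{ destruct Hfg as [d [Hd H]]; apply H.
  replace (p - p)%C with (RtoC 0) by ring; now rewrite Cmod_0. }
apply near_imp with (2 := near_and _ _ _ Hfg Hf); intros z [E1 E2].
now rewrite <- E1, <- Hp.
Qed.

Lemma near_all (p : C) (P : C -> Prop) : (forall z, P z) -> near p P.
Proof. intros H; exists 1; split; [lra|auto]. Qed.

Lemma quad_at_const (c p : C) : quad_at (fun _ => c) p 0%C.
Proof.
exists (fun _ => 0%C); split; [apply cont_at_const|].
apply near_all; intros z; ring.
Qed.

Lemma quad_at_id (p : C) : quad_at (fun z => z) p 1%C.
Proof.
exists (fun _ => 0%C); split; [apply cont_at_const|].
apply near_all; intros z; ring.
Qed.

Lemma quad_at_plus (f g : C -> C) (p b c : C) :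
  quad_at f p b -> quad_at g p c ->
  quad_at (fun z => f z + g z)%C p (b + c)%C.
Proof.
intros [l [Hl Hf]] [m [Hm Hg]]; exists (fun z => l z + m z)%C; split.
- now apply cont_at_plus.
- apply near_imp with (2 := near_and _ _ _ Hf Hg); intros z [-> ->]; ring.
Qed.

Lemma quad_at_mult (f g : C -> C) (p b c : C) :
  quad_at f p b -> quad_at g p c ->
  quad_at (fun z => f z * g z)%C p (b * g p + f p * c)%C.
Proof.
intros [l [Hl Hf]] [m [Hm Hg]].
exists (fun z => f p * m z + g p * l z + b * c
          + (z - p) * (b * m z + c * l z + (z - p) * (l z * m z)))%C; split.
- cont_at_tac.
- apply near_imp with (2 := near_and _ _ _ Hf Hg); intros z [-> ->]; ring.
Qed.

Lemma quad_at_cont (f : C -> C) (p b : C) : quad_at f p b -> cont_at f p.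
Proof.
intros [l [Hl Hf]].
set (g := fun z => (f p + b * (z - p) + (z - p) ^ 2 * l z)%C).
assert (Hg : cont_at g p).
{ unfold g; simpl; cont_at_tac. }
assert (Hgp : g p = f p) by (unfold g; ring).
rewrite cont_at_iff in Hg; apply cont_at_iff; intros eps Heps.
apply near_imp with (2 := near_and _ _ _ Hf (Hg eps Heps)).
intros z [E1 E2]; rewrite E1; rewrite Hgp in E2; exact E2.
Qed.

Lemma quad_at_inv (f : C -> C) (p b : C) :
  quad_at f p b -> f p <> 0%C ->
  quad_at (fun z => / f z)%C p (- b / (f p * f p))%C.
Proof.
intros Hq Hp; assert (Hc := quad_at_cont _ _ _ Hq).
destruct Hq as [l [Hl Hf]].
exists (fun z => (b * b + (z - p) * (b * l z) + - f p * l z)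
                 * (/ f z * / (f p * f p)))%C; split.
- cont_at_tac.
- apply near_imp with (2 := near_and _ _ _ Hf (cont_at_near_ne _ _ Hc Hp)).
  intros z [E Hz].
  set (N := (b * b + (z - p) * (b * l z) + - f p * l z)%C).
  assert (EN : (f p * f p = f z * (f p - b * (z - p)) + (z - p) ^ 2 * N)%C)
    by (unfold N; rewrite E; ring).
  transitivity ((f p * f p) / (f z * (f p * f p)))%C; [field; now split|].
  rewrite EN at 1; field; now split.
Qed.

(** The remainder of the expansion is an iterated slope, which is analytic and
    therefore continuous.  The slope function is included since it is a factor
    of the function to which the maximum principle is applied. *)
Lemma analytic_at_slope_quad (f : C -> C) (p : C) :
  analytic_at f p ->
  exists b : C, quad_at f p b /\ exists c : C, quad_at (slope f p b) p c.
Proof.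
assert (Hq : forall g, analytic_at g p ->
          exists b, quad_at g p b /\ analytic_at (slope g p b) p).
{ intros g Hg; destruct (analytic_at_slope g p Hg) as [b Hb].
  exists b; split; [|exact Hb].
  destruct (analytic_at_slope _ _ Hb) as [c Hc].
  exists (slope (slope g p b) p c); split; [now apply analytic_at_cont|].
  apply near_all; intros z.
  rewrite (slope_eq g p b z) at 1; rewrite (slope_eq (slope g p b) p c z) at 1.
  rewrite slope_center; ring. }
intros Hf; destruct (Hq f Hf) as [b [Hb Hs]].
destruct (Hq _ Hs) as [c [Hc _]].
exists b; split; [exact Hb|now exists c].
Qed.

Lemma quad_at_bound (f : C -> C) (p b : C) :
  quad_at f p b ->
  exists K : R, 0 < K /\
    near p (fun z => Cmod (f z - f p - b * (z - p)) <= K * Cmod (z - p) ^ 2).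
Proof.
intros [l [Hl Hf]]; rewrite cont_at_iff in Hl.
exists (Cmod (l p) + 1); split; [generalize (Cmod_ge_0 (l p)); lra|].
apply near_imp with (2 := near_and _ _ _ Hf (Hl 1 Rlt_0_1)).
intros z [E Hz]; rewrite E.
replace (f p + b * (z - p) + (z - p) ^ 2 * l z - f p - b * (z - p))%C
  with (l z * (z - p) ^ 2)%C by ring.
rewrite Cmod_mult, Cmod_pow; apply Rmult_le_compat_r; [apply pow2_ge_0|].
assert (T := Cmod_triangle (l p) (l z - l p)%C).
replace (l p + (l z - l p))%C with (l z) in T by ring; lra.
Qed.

Lemma quad_at_C_derive (f : C -> C) (p b : C) :
  quad_at f p b -> C_derive f p = b.
Proof.
intros Hf; destruct (quad_at_bound f p b Hf) as [K [HK [d [Hd H]]]].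
apply is_C_lim_unique.
apply filterlim_locally; intros eps.
assert (He := cond_pos eps).
assert (Hm : 0 < Rmin d (eps / K)).
{ apply Rmin_pos; [exact Hd|now apply Rdiv_lt_0_compat]. }
unfold locally', within; apply locally_C.
exists (mkposreal _ Hm); intros z Hz Hne.
change (Cmod (z - p) < Rmin d (eps / K)) in Hz.
assert (Hz1 := Rlt_le_trans _ _ _ Hz (Rmin_l _ _)).
assert (Hz2 := Rlt_le_trans _ _ _ Hz (Rmin_r _ _)).
apply C_NormedModule_mixin_compat1.
change (Cmod ((f z - f p) / (z - p) - b) < eps).
assert (Hnz := Cminus_ne z p Hne).
assert (Hpos : 0 < Cmod (z - p)) by now apply Cmod_gt_0.
replace ((f z - f p) / (z - p) - b)%C
  with ((f z - f p - b * (z - p)) / (z - p))%C by (field; exact Hnz).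
rewrite Cmod_div by exact Hnz.
apply Rle_lt_trans with (K * Cmod (z - p)).
- apply Rle_div_l; [exact Hpos|].
  apply Rle_trans with (1 := H z Hz1); apply Req_le; ring.
- rewrite Rmult_comm; now apply Rlt_div_r.
Qed.

Lemma analytic_at_quad_derive (f : C -> C) (p : C) :
  analytic_at f p -> quad_at f p (C_derive f p).
Proof.
intros Hf; destruct (analytic_at_slope_quad f p Hf) as [b [Hb _]].
now rewrite (quad_at_C_derive f p b Hb).
Qed.

Lemma analytic_quad_slope (f : C -> C) (p z : C) :
  analytic_at f p -> analytic_at f z ->
  exists c : C, quad_at (slope f p (C_derive f p)) z c.
Proof.
intros Hp Hz.
destruct (excluded_middle_informative (z = p)) as [->|Hne].
- destruct (analytic_at_slope_quad f p Hp) as [b [Hb Hc]].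
  now rewrite (quad_at_C_derive f p b Hb).
- assert (Hd := Cminus_ne z p Hne).
  assert (Hid : quad_at (fun w => w + - p)%C z (1 + 0)%C).
  { apply quad_at_plus; [apply quad_at_id|apply quad_at_const]. }
  eexists; eapply quad_at_ext.
  2: { eapply quad_at_mult.
       - eapply quad_at_plus with (g := fun _ => (- f p)%C).
         + exact (analytic_at_quad_derive f z Hz).
         + apply quad_at_const.
       - exact (quad_at_inv _ _ _ Hid Hd). }
  assert (Hn : near z (fun w => w - p <> 0)%C).
  { exact (cont_at_near_ne _ _ (quad_at_cont _ _ _ Hid) Hd). }
  apply near_imp with (2 := Hn); intros w Hw.
  unfold slope; destruct (excluded_middle_informative (w = p)) as [->|_].
  + exfalso; apply Hw; ring.
  + reflexivity.
Qed.

(** * The maximum principle *)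

(** Compactness of the closed disk, for a property that gets weaker as its
    parameter decreases.  The disk is put in a square, and the points of the
    square that lie outside it get a neighbourhood which misses the disk. *)
Lemma disk_uniform (r : R) (P : R -> C -> Prop) :
  (forall d e z, 0 < d <= e -> P e z -> P d z) ->
  (forall p, Cmod p <= r -> exists d, 0 < d /\
     forall z, Cmod z <= r -> Cmod (z - p) < d -> P d z) ->
  exists d, 0 < d /\ forall z, Cmod z <= r -> P d z.
Proof.
intros Hmono Hloc.
(* The factor 2 absorbs the ratio sqrt 2 of the modulus to the max norm. *)
assert (Hall : forall x y : R, exists d : posreal,
  forall z, Cmod z <= r -> Cmod (z - (x, y)) < 2 * d -> P d z).
{ intros x y; destruct (Rle_lt_dec (Cmod (x, y)) r) as [Hin|Hout].
  - destruct (Hloc _ Hin) as [d [Hd H]].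
    assert (Hd2 : 0 < d / 2) by lra.
    exists (mkposreal _ Hd2); simpl; intros z Hz Hzp.
    apply Hmono with d; [lra|]; apply H; [exact Hz|lra].
  - assert (Hd : 0 < (Cmod (x, y) - r) / 2) by lra.
    exists (mkposreal _ Hd); simpl; intros z Hz Hzp; exfalso.
    generalize (Cmod_le_sub z (x, y)); lra. }
pose (delta := fun x y =>
  proj1_sig (constructive_indefinite_description _ (Hall x y))).
destruct (compactness_value_2d (- r) r (- r) r delta) as [d Hd].
exists d; split; [apply cond_pos|]; intros [x y] Hz.
assert (Hxy := Rle_trans _ _ _ (Rmax_Cmod (x, y)) Hz); simpl in Hxy.
assert (Hx := Rle_trans _ _ _ (Rmax_l _ _) Hxy).
assert (Hy := Rle_trans _ _ _ (Rmax_r _ _) Hxy).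
apply Rabs_le_between in Hx; apply Rabs_le_between in Hy.
apply NNPP; intros HnP; apply (Hd x y Hx Hy).
intros [u [v [_ [_ [Hu [Hv Hduv]]]]]]; apply HnP.
apply Hmono with (delta u v); [split; [apply cond_pos|exact Hduv]|].
revert Hu Hv; unfold delta.
destruct (constructive_indefinite_description _ (Hall u v)) as [e He]; simpl.
intros Hu Hv; apply He; [exact Hz|].
apply Rle_lt_trans with (1 := Cmod_2Rmax _); simpl.
change (x + - u) with (x - u); change (y + - v) with (y - v).
assert (Hm := Rmax_lub_lt _ _ _ Hu Hv).
assert (H0 := Rle_trans _ _ _ (Rabs_pos (x - u)) (Rmax_l _ (Rabs (y - v)))).
assert (Hs : sqrt 2 < 2).
{ rewrite <- (sqrt_square 2) at 2 by lra; apply sqrt_lt_1; lra. }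
assert (Hs0 := sqrt_pos 2).
apply Rle_lt_trans with (2 * Rmax (Rabs (x - u)) (Rabs (y - v))); nra.
Qed.

(** If the supremum S were not attained, each point would have a neighbourhood
    on which the function stays below S by a margin, and by compactness a single
    margin would serve for the whole disk. *)
Lemma disk_max (r : R) (u : C -> R) :
  0 <= r ->
  (forall p, Cmod p <= r -> forall eps, 0 < eps ->
     near p (fun z => Rabs (u z - u p) < eps)) ->
  exists p, Cmod p <= r /\ forall z, Cmod z <= r -> u z <= u p.
Proof.
intros Hr Hu; apply NNPP; intros Hno.
assert (Hup : forall p, Cmod p <= r -> exists q, Cmod q <= r /\ u p < u q).
{ intros p Hp; apply NNPP; intros Hq; apply Hno; exists p; split; [exact Hp|].
  intros z Hz; apply Rnot_lt_le; intros Hlt; apply Hq; now exists z. }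
assert (Hbd : exists d, 0 < d /\ forall z, Cmod z <= r -> u z < / d).
{ apply disk_uniform with (P := fun d z => u z < / d).
  - intros d e z [Hd Hde] He; apply Rlt_le_trans with (1 := He).
    now apply Rinv_le_contravar.
  - intros p Hp; destruct (Hu p Hp 1 Rlt_0_1) as [d [Hd H]].
    assert (HR := Rabs_pos (u p)).
    assert (HI : 0 < / (Rabs (u p) + 1)) by (apply Rinv_0_lt_compat; lra).
    exists (Rmin d (/ (Rabs (u p) + 1))); split; [now apply Rmin_pos|].
    intros z _ Hz.
    assert (Hz1 := H z (Rlt_le_trans _ _ _ Hz (Rmin_l _ _))).
    apply Rlt_le_trans with (Rabs (u p) + 1).
    + apply Rabs_def2 in Hz1; generalize (Rle_abs (u p)); lra.
    + rewrite <- (Rinv_inv (Rabs (u p) + 1)) at 1.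
      apply Rinv_le_contravar; [now apply Rmin_pos|apply Rmin_r]. }
destruct Hbd as [d0 [Hd0 Hbd]].
destruct (completeness (fun x => exists z, Cmod z <= r /\ x = u z))
  as [S [HS1 HS2]].
{ exists (/ d0); intros x [z [Hz ->]]; now apply Rlt_le, Hbd. }
{ exists (u (RtoC 0)), (RtoC 0); split; [now rewrite Cmod_0|reflexivity]. }
destruct (disk_uniform r (fun d z => u z <= S - d)) as [d [Hd H]].
- intros d e z Hde He; lra.
- intros p Hp; destruct (Hup p Hp) as [q [Hq Hpq]].
  assert (HSq : u q <= S) by (apply HS1; now exists q).
  destruct (Hu p Hp ((S - u p) / 2)) as [d [Hd H]]; [lra|].
  exists (Rmin d ((S - u p) / 2)); split; [apply Rmin_pos; lra|].
  intros z _ Hz.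
  assert (Hz1 := H z (Rlt_le_trans _ _ _ Hz (Rmin_l _ _))).
  assert (Hz2 := Rmin_r d ((S - u p) / 2)).
  apply Rabs_def2 in Hz1; lra.
- assert (S <= S - d); [|lra].
  apply HS2; intros x [z [Hz ->]]; now apply H.
Qed.

Lemma cont_at_Cmod2 (f : C -> C) (p : C) (eps : R) :
  cont_at f p -> 0 < eps ->
  near p (fun z => Rabs (Cmod (f z) ^ 2 - Cmod (f p) ^ 2) < eps).
Proof.
rewrite cont_at_iff; intros Hf Heps.
assert (HB := Cmod_ge_0 (f p)); set (B := Cmod (f p)) in *.
assert (Hm : 0 < Rmin 1 (eps / (2 * B + 1))).
{ apply Rmin_pos; [lra|apply Rdiv_lt_0_compat; lra]. }
apply near_imp with (2 := Hf _ Hm); intros z Hz.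
assert (Hz1 := Rlt_le_trans _ _ _ Hz (Rmin_l _ _)).
assert (Hz2 := Rlt_le_trans _ _ _ Hz (Rmin_r _ _)).
apply Rlt_div_r in Hz2; [|lra].
assert (T1 := Cmod_le_sub (f z) (f p)).
assert (T2 := Cmod_triangle (f p) (f z - f p)%C).
replace (f p + (f z - f p))%C with (f z) in T2 by ring; fold B in T1, T2.
set (A := Cmod (f z)) in *; set (D := Cmod (f z - f p)) in *.
assert (HA : 0 <= A) by apply Cmod_ge_0.
replace (A ^ 2 - B ^ 2) with ((A - B) * (A + B)) by ring.
rewrite Rabs_mult, (Rabs_pos_eq (A + B)) by lra.
assert (HAB : Rabs (A - B) <= D) by (apply Rabs_le; lra).
apply Rle_lt_trans with (D * (A + B)); [apply Rmult_le_compat_r; lra|].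
assert (0 <= D) by apply Cmod_ge_0.
apply Rle_lt_trans with (2 := Hz2); apply Rmult_le_compat_l; lra.
Qed.

Lemma Cmod2_expand (z : C) : Cmod z ^ 2 = fst z ^ 2 + snd z ^ 2.
Proof. exact (Cmod2_alt z). Qed.

(** Let w run over the four numbers i^k t.  With c the conjugate of h(p),
    |h(p+w)|^2 >= 2 Re(c h(p+w)) - |h(p)|^2, and the right-hand side is linear
    in h.  In the sum over the four points the terms in w and w^2 of the
    expansion cancel, leaving an error o(t^2), whereas the terms eps |p+w|^2
    contribute a gain 4 eps t^2. *)
Lemma no_interior_max (h : C -> C) (p b : C) (eps : R) :
  0 < eps -> quad_at h p b ->
  ~ near p (fun z => Cmod (h z) ^ 2 + eps * Cmod z ^ 2
                     <= Cmod (h p) ^ 2 + eps * Cmod p ^ 2).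
Proof.
intros Heps [l [Hl Hh]] Hmax.
rewrite cont_at_iff in Hl.
set (c := Cconj (h p)).
assert (Hc := Cmod_ge_0 c).
set (eta := eps / (4 * (Cmod c + 1))).
assert (Heta : 0 < eta) by (apply Rdiv_lt_0_compat; lra).
assert (Hceta : 4 * (Cmod c * eta) <= eps).
{ apply Rle_trans with (4 * ((Cmod c + 1) * eta)); [nra|].
  apply Req_le; unfold eta; field; lra. }
destruct (near_and _ _ _ Hmax (near_and _ _ _ Hh (Hl eta Heta)))
  as [d [Hd H]].
(* The maximality at p + w for w = s + i t, in real coordinates, with the
   remainder estimated by eta. *)
assert (Hpt : forall s t : R, sqrt (s ^ 2 + t ^ 2) < d ->
  2 * (fst (c * b)%C * s - snd (c * b)%C * t)
  + 2 * (fst (c * l p)%C * (s ^ 2 - t ^ 2) - 2 * (snd (c * l p)%C * (s * t)))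
  - 2 * (Cmod c * eta) * (s ^ 2 + t ^ 2)
  + eps * (2 * (fst p * s) + 2 * (snd p * t) + (s ^ 2 + t ^ 2)) <= 0).
{ intros s t Hst; set (w := (s, t) : C).
  destruct (H (p + w)%C) as [H1 [H2 H3]].
  { replace (p + w - p)%C with w by ring; exact Hst. }
  replace (p + w - p)%C with w in H2 by ring.
  set (hq := h (p + w)%C) in *; set (e := (l (p + w)%C - l p)%C) in *.
  assert (H4 : 2 * Re (c * hq) <= Cmod (h p) ^ 2 + Cmod hq ^ 2).
  { rewrite !Cmod2_expand; unfold c, Cconj, Re; simpl.
    generalize (Rle_0_sqr (fst (h p) - fst hq))
      (Rle_0_sqr (snd (h p) - snd hq)); unfold Rsqr; nra. }
  assert (E : Re (c * hq) = Cmod (h p) ^ 2 + Re (c * b * w)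
              + Re (c * l p * w ^ 2) + Re (c * e * w ^ 2)).
  { rewrite H2.
    replace (l (p + w)%C) with (l p + e)%C by (unfold e; ring).
    rewrite Cmod2_expand; unfold c, Cconj, Re; simpl; ring. }
  assert (H5 : - (Cmod c * eta * (s ^ 2 + t ^ 2)) <= Re (c * e * w ^ 2)).
  { assert (H6 := re_le_Cmod (c * e * w ^ 2)).
    rewrite !Cmod_mult, Cmod_pow, (Cmod2_expand w) in H6; simpl fst in H6.
    simpl snd in H6.
    apply Rabs_le_between in H6.
    assert (Cmod c * Cmod e * (s ^ 2 + t ^ 2)
            <= Cmod c * eta * (s ^ 2 + t ^ 2)); [|lra].
    apply Rmult_le_compat_r; [nra|apply Rmult_le_compat_l; lra]. }
  assert (E1 : Re (c * b * w) = fst (c * b)%C * s - snd (c * b)%C * t)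
    by reflexivity.
  assert (E2 : Re (c * l p * w ^ 2) = fst (c * l p)%C * (s ^ 2 - t ^ 2)
               - 2 * (snd (c * l p)%C * (s * t))).
  { unfold Re; simpl; ring. }
  assert (E3 : Cmod (p + w) ^ 2 = Cmod p ^ 2 + (2 * (fst p * s)
               + 2 * (snd p * t) + (s ^ 2 + t ^ 2))).
  { rewrite !Cmod2_expand; simpl; ring. }
  rewrite E3, Rmult_plus_distr_l in H1; lra. }
assert (Hd2 : sqrt ((d / 2) ^ 2) = d / 2) by (apply sqrt_pow2; lra).
assert (P1 := Hpt (d / 2) 0); assert (P2 := Hpt (- (d / 2)) 0).
assert (P3 := Hpt 0 (d / 2)); assert (P4 := Hpt 0 (- (d / 2))).
replace ((d / 2) ^ 2 + 0 ^ 2) with ((d / 2) ^ 2) in P1 by ring.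
replace ((- (d / 2)) ^ 2 + 0 ^ 2) with ((d / 2) ^ 2) in P2 by ring.
replace (0 ^ 2 + (d / 2) ^ 2) with ((d / 2) ^ 2) in P3 by ring.
replace (0 ^ 2 + (- (d / 2)) ^ 2) with ((d / 2) ^ 2) in P4 by ring.
rewrite Hd2 in P1, P2, P3, P4.
assert (Q1 := P1 ltac:(lra)); assert (Q2 := P2 ltac:(lra)).
assert (Q3 := P3 ltac:(lra)); assert (Q4 := P4 ltac:(lra)).
clear P1 P2 P3 P4 Hpt H Hd2 Hmax Hh Hl.
assert (Ht : 0 < (d / 2) ^ 2) by (apply pow_lt; lra).
set (X := (c * b)%C) in *; set (Y := (c * l p)%C) in *.
set (t := d / 2) in *.
assert (4 * (eps * t ^ 2) - 8 * (Cmod c * eta) * t ^ 2 <= 0).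
{ replace ((- t) ^ 2) with (t ^ 2) in * by ring. lra. }
nra.
Qed.

(** The perturbation by eps |z|^2 forces the maximum of |h|^2 + eps |z|^2 onto
    the circle; then eps tends to 0. *)
Lemma maximum_principle (h : C -> C) (r B : R) :
  0 <= r ->
  (forall p, Cmod p <= r -> exists b, quad_at h p b) ->
  (forall z, Cmod z = r -> Cmod (h z) <= B) ->
  forall z, Cmod z <= r -> Cmod (h z) <= B.
Proof.
intros Hr Hq Hbd z Hz.
assert (Hsq : forall eps, 0 < eps -> Cmod (h z) ^ 2 <= B ^ 2 + eps * r ^ 2).
{ intros eps Heps.
  destruct (disk_max r (fun z => Cmod (h z) ^ 2 + eps * Cmod z ^ 2) Hr)
    as [p [Hp Hmax]].
  - intros p Hp e He; destruct (Hq p Hp) as [b Hb].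
    assert (He1 : 0 < e / 2) by lra.
    assert (He2 : 0 < e / 2 / eps) by now apply Rdiv_lt_0_compat.
    apply near_imp with (2 := near_and _ _ _
      (cont_at_Cmod2 h p _ (quad_at_cont _ _ _ Hb) He1)
      (cont_at_Cmod2 (fun z => z) p _ (cont_at_id p) He2)).
    intros w [H1 H2].
    replace (Cmod (h w) ^ 2 + eps * Cmod w ^ 2
             - (Cmod (h p) ^ 2 + eps * Cmod p ^ 2))
      with (Cmod (h w) ^ 2 - Cmod (h p) ^ 2
            + eps * (Cmod w ^ 2 - Cmod p ^ 2)) by ring.
    apply Rle_lt_trans with (1 := Rabs_triang _ _).
    rewrite Rabs_mult, (Rabs_pos_eq eps) by lra.
    apply Rlt_div_r in H2; [lra|exact Heps].
  - simpl in Hmax.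
    destruct (Rle_lt_or_eq_dec _ _ Hp) as [Hin|Hbdry].
    + exfalso; destruct (Hq p Hp) as [b Hb].
      apply (no_interior_max h p b eps Heps Hb).
      exists (r - Cmod p); split; [lra|]; intros w Hw; apply Hmax.
      assert (T := Cmod_triangle p (w - p)%C).
      replace (p + (w - p))%C with w in T by ring; lra.
    + assert (H1 := Hmax z Hz); assert (H2 := Hbd p Hbdry).
      rewrite Hbdry in H1.
      assert (0 <= eps * (Cmod z * (Cmod z * 1))).
      { apply Rmult_le_pos; [lra|apply (pow2_ge_0 (Cmod z))]. }
      assert (Cmod (h p) ^ 2 <= B ^ 2).
      { apply pow_incr; split; [apply Cmod_ge_0|exact H2]. }
      simpl in *; lra. }
assert (HB : 0 <= B).
{ apply Rle_trans with (1 := Cmod_ge_0 (h (RtoC r))).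
  apply Hbd; rewrite Cmod_R; now apply Rabs_pos_eq. }
apply Rsqr_incr_0; [|apply Cmod_ge_0|exact HB].
unfold Rsqr; apply Rnot_lt_le; intros Hlt.
assert (Hpos : 0 < r ^ 2 + 1) by (generalize (pow2_ge_0 r); lra).
set (g := Cmod (h z) * Cmod (h z) - B * B).
assert (Hg : 0 < g) by (unfold g; lra).
assert (H := Hsq (g / (r ^ 2 + 1)) (Rdiv_lt_0_compat _ _ Hg Hpos)).
assert (g / (r ^ 2 + 1) * r ^ 2 < g).
{ apply Rlt_le_trans with (g / (r ^ 2 + 1) * (r ^ 2 + 1)).
  - apply Rmult_lt_compat_l; [now apply Rdiv_lt_0_compat|lra].
  - apply Req_le; field; lra. }
unfold g in *; simpl in *; lra.
Qed.

(** * The derivative of a bounded analytic function *)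

(** The difference of the squares of the two sides is
    (M^2 - |x|^2) (M^2 - |y|^2). *)
Lemma blaschke_le (x y : C) (M : R) :
  Cmod x <= M -> Cmod y <= M ->
  M * Cmod (x - y) <= Cmod (RtoC (M ^ 2) - Cconj y * x).
Proof.
intros Hx Hy.
assert (HM : 0 <= M) by (generalize (Cmod_ge_0 x); lra).
apply Rsqr_incr_0; [|apply Rmult_le_pos; [exact HM|apply Cmod_ge_0]
                    |apply Cmod_ge_0].
rewrite Rsqr_mult, !Rsqr_pow2, !Cmod2_expand.
assert (Hx2 : Cmod x ^ 2 <= M ^ 2)
  by (apply pow_incr; split; [apply Cmod_ge_0|exact Hx]).
assert (Hy2 : Cmod y ^ 2 <= M ^ 2)
  by (apply pow_incr; split; [apply Cmod_ge_0|exact Hy]).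
rewrite Cmod2_expand in Hx2, Hy2.
assert (H := Rmult_le_pos _ _ (proj1 (Rminus_le_0 _ _) Hx2)
                              (proj1 (Rminus_le_0 _ _) Hy2)).
destruct x as [x1 x2], y as [y1 y2]; unfold Cconj; simpl in *; nra.
Qed.

(** On the circle of radius r, |r^2 - conj(a) z| = |z| |conj(z) - conj(a)|. *)
Lemma blaschke_circle (a z : C) (r : R) :
  Cmod z = r -> Cmod (RtoC (r ^ 2) - Cconj a * z) = r * Cmod (z - a).
Proof.
intros Hz; assert (Hr : 0 <= r) by (rewrite <- Hz; apply Cmod_ge_0).
apply Rsqr_inj;
  [apply Cmod_ge_0|apply Rmult_le_pos; [exact Hr|apply Cmod_ge_0]|].
rewrite Rsqr_mult, !Rsqr_pow2, !Cmod2_expand.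
assert (H := Cmod2_expand z); rewrite Hz in H.
destruct a as [a1 a2], z as [z1 z2]; unfold Cconj; simpl fst in *.
simpl snd in *.
transitivity (r ^ 2 * r ^ 2 - 2 * r ^ 2 * (a1 * z1 + a2 * z2)
              + (a1 ^ 2 + a2 ^ 2) * (z1 ^ 2 + z2 ^ 2)); [simpl; ring|].
rewrite <- H at 1.
transitivity (r ^ 2 * ((z1 ^ 2 + z2 ^ 2) - 2 * (a1 * z1 + a2 * z2)
              + (a1 ^ 2 + a2 ^ 2))); [rewrite <- H; ring|simpl; ring].
Qed.

(** The maximum principle is applied to h, the slope of f at a times
    (r^2 - conj(a) z) / (M^2 - conj(f(a)) f(z)).  On the circle of radius r, by
    [blaschke_circle] and [blaschke_le], |h| <= r / M; at a the slope is f'(a).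
    The strict bound by M keeps the denominator away from 0. *)
Lemma schwarz_pick_radius (f : C -> C) (a : C) (r M : R) :
  analytic_on_disk f -> Cmod a < r < 1 ->
  (forall z, in_disk z -> Cmod (f z) < M) ->
  Cmod (C_derive f a) * (r ^ 2 - Cmod a ^ 2) <= r * M.
Proof.
intros Hf [Har Hr1] HM.
assert (Ha0 := Cmod_ge_0 a).
assert (Hr0 : 0 < r) by lra.
assert (Hain : in_disk a) by (unfold in_disk; lra).
assert (HfaM := HM a Hain).
assert (HM0 : 0 < M) by (generalize (Cmod_ge_0 (f a)); lra).
assert (Hden : forall z, in_disk z ->
          (RtoC (M ^ 2) - Cconj (f a) * f z)%C <> 0%C).
{ intros z Hz E.
  assert (E' : RtoC (M ^ 2) = (Cconj (f a) * f z)%C) by now apply Ceq_minus.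
  apply (f_equal Cmod) in E'.
  rewrite Cmod_mult, Cmod_conj, Cmod_R, Rabs_pos_eq in E' by nra.
  assert (H1 := HM z Hz); assert (H2 := Cmod_ge_0 (f z)).
  assert (H3 := Cmod_ge_0 (f a)); nra. }
set (h := fun z => (slope f a (C_derive f a) z
  * ((RtoC (r ^ 2) + - Cconj a * z)
     * / (RtoC (M ^ 2) + - Cconj (f a) * f z)))%C).
assert (Hh : forall z, Cmod z <= r -> Cmod (h z) <= r / M).
{ apply maximum_principle; [lra| |].
  - intros p Hp; assert (Hpin : in_disk p) by (unfold in_disk; lra).
    destruct (analytic_quad_slope f a p (Hf a Hain) (Hf p Hpin)) as [c Hc].
    eexists; unfold h.
    apply quad_at_mult; [exact Hc|].
    apply quad_at_mult.
    + apply quad_at_plus; [apply quad_at_const|].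
      apply quad_at_mult; [apply quad_at_const|apply quad_at_id].
    + apply (quad_at_inv (fun z => RtoC (M ^ 2) + - Cconj (f a) * f z)%C).
      * apply quad_at_plus; [apply quad_at_const|].
        apply quad_at_mult; [apply quad_at_const|].
        exact (analytic_at_quad_derive f p (Hf p Hpin)).
      * replace (RtoC (M ^ 2) + - Cconj (f a) * f p)%C
          with (RtoC (M ^ 2) - Cconj (f a) * f p)%C by ring.
        now apply Hden.
  - intros z Hz; assert (Hzin : in_disk z) by (unfold in_disk; lra).
    assert (Hza : z <> a) by (intros E; rewrite E in Hz; lra).
    assert (Hza0 := Cminus_ne z a Hza).
    assert (Hpos : 0 < Cmod (z - a)) by now apply Cmod_gt_0.
    assert (HD := Hden z Hzin).
    assert (HDpos : 0 < Cmod (RtoC (M ^ 2) - Cconj (f a) * f z))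
      by now apply Cmod_gt_0.
    assert (Hnum := blaschke_circle a z r Hz).
    assert (Hquot := blaschke_le (f z) (f a) M (Rlt_le _ _ (HM z Hzin))
                       (Rlt_le _ _ HfaM)).
    unfold h, slope.
    destruct (excluded_middle_informative (z = a)) as [E|_]; [easy|].
    replace (RtoC (r ^ 2) + - Cconj a * z)%C
      with (RtoC (r ^ 2) - Cconj a * z)%C by ring.
    replace (RtoC (M ^ 2) + - Cconj (f a) * f z)%C
      with (RtoC (M ^ 2) - Cconj (f a) * f z)%C by ring.
    rewrite !Cmod_mult, Cmod_div, Cmod_inv, Hnum by assumption.
    set (D := Cmod (RtoC (M ^ 2) - Cconj (f a) * f z)) in *.
    replace (Cmod (f z - f a) / Cmod (z - a) * (r * Cmod (z - a) * / D))
      with (r / M * (M * Cmod (f z - f a) / D)) by (field; lra).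
    rewrite <- (Rmult_1_r (r / M)) at 2.
    apply Rmult_le_compat_l; [apply Rlt_le, Rdiv_lt_0_compat; lra|].
    apply Rle_div_l; [exact HDpos|lra]. }
assert (H := Hh a (Rlt_le _ _ Har)).
unfold h in H; rewrite slope_center in H.
assert (E1 : (RtoC (r ^ 2) + - Cconj a * a)%C = RtoC (r ^ 2 - Cmod a ^ 2)).
{ rewrite RtoC_minus, Cmod2_conj; ring. }
assert (E2 : (RtoC (M ^ 2) + - Cconj (f a) * f a)%C
             = RtoC (M ^ 2 - Cmod (f a) ^ 2)).
{ rewrite RtoC_minus, Cmod2_conj; ring. }
assert (Hfa0 := Cmod_ge_0 (f a)).
assert (HG : 0 < M ^ 2 - Cmod (f a) ^ 2) by nra.
assert (HA : 0 < r ^ 2 - Cmod a ^ 2) by nra.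
rewrite E1, E2, !Cmod_mult, Cmod_inv, !Cmod_R, !Rabs_pos_eq in H
  by (try (intros E; apply RtoC_inj in E); lra).
set (G := M ^ 2 - Cmod (f a) ^ 2) in *.
set (Q := Cmod (C_derive f a) * (r ^ 2 - Cmod a ^ 2)) in *.
assert (H' : Q / G <= r / M) by (unfold Q, Rdiv; lra).
apply (Rle_div_l Q _ G HG) in H'.
apply Rle_trans with (1 := H').
replace (r * M) with (r / M * M ^ 2) by (field; lra).
apply Rmult_le_compat_l; [apply Rlt_le, Rdiv_lt_0_compat; lra|].
unfold G; nra.
Qed.

(** The limiting case r -> 1 and M -> m of [schwarz_pick_radius]. *)
Lemma schwarz_pick (f : C -> C) (a : C) (m : R) :
  analytic_on_disk f -> in_disk a ->
  (forall z, in_disk z -> Cmod (f z) <= m) ->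
  (1 - Cmod a ^ 2) * Cmod (C_derive f a) <= m.
Proof.
intros Hf Ha Hm; unfold in_disk in Ha; apply Rnot_lt_le; intros Hlt.
assert (Ha0 := Cmod_ge_0 a).
assert (HD := Cmod_ge_0 (C_derive f a)).
assert (Hm0 : 0 <= m).
{ apply Rle_trans with (1 := Cmod_ge_0 (f a)); now apply Hm. }
set (D := Cmod (C_derive f a)) in *; set (A := Cmod a) in *.
set (g := (1 - A ^ 2) * D - m) in *.
assert (Hg : 0 < g) by (unfold g; lra).
set (e := Rmin ((1 - A) / 2) (g / (4 * (D + 1)))).
assert (He : 0 < e).
{ apply Rmin_pos; [lra|apply Rdiv_lt_0_compat; lra]. }
assert (He1 : e <= (1 - A) / 2) by apply Rmin_l.
assert (He2 : e <= g / (4 * (D + 1))) by apply Rmin_r.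
apply Rle_div_r in He2; [|lra].
assert (H := schwarz_pick_radius f a (1 - e) (m + g / 4) Hf).
assert (H' : D * ((1 - e) ^ 2 - A ^ 2) <= (1 - e) * (m + g / 4)).
{ apply H; [fold A; lra|]; intros z Hz; generalize (Hm z Hz); lra. }
assert ((1 - e) * (m + g / 4) <= m + g / 4) by nra.
assert (D * ((1 - e) ^ 2 - A ^ 2) >= (1 - A ^ 2) * D - 2 * (e * D)) by nra.
unfold g in *; nra.
Qed.

(** * Growth of functions with bounded Bloch seminorm *)

(** A real-valued function is needed for the mean value theorem; the factor [c]
    allows projecting on the direction of the increment of f. *)
Lemma is_derive_ray (f : C -> C) (c z : C) (t : R) :
  analytic_at f (RtoC t * z)%C ->
  is_derive (fun s : R => Re (c * f (RtoC s * z)%C)) t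
            (Re (c * C_derive f (RtoC t * z)%C * z)).
Proof.
intros Hf; set (p := (RtoC t * z)%C) in *; set (b := C_derive f p).
destruct (quad_at_bound f p b (analytic_at_quad_derive f p Hf))
  as [K [HK [d [Hd H]]]].
apply is_derive_Reals; intros eps Heps.
assert (Hz0 := Cmod_ge_0 z); assert (Hc0 := Cmod_ge_0 c).
set (Q := Cmod c * K * Cmod z ^ 2).
assert (HQ : 0 <= Q).
{ apply Rmult_le_pos; [apply Rmult_le_pos; lra|apply pow2_ge_0]. }
assert (Hdel : 0 < Rmin (d / (Cmod z + 1)) (eps / (Q + 1))).
{ apply Rmin_pos; apply Rdiv_lt_0_compat; lra. }
exists (mkposreal _ Hdel); intros h Hh Hlt; simpl in Hlt.
assert (H1 := Rlt_le_trans _ _ _ Hlt (Rmin_l _ _)).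
assert (H2 := Rlt_le_trans _ _ _ Hlt (Rmin_r _ _)).
apply Rlt_div_r in H1; [|lra]; apply Rlt_div_r in H2; [|lra].
assert (Habs : 0 < Rabs h) by now apply Rabs_pos_lt.
set (q := (RtoC (t + h) * z)%C).
assert (Eq : (q - p)%C = (RtoC h * z)%C)
  by (unfold q, p; rewrite RtoC_plus; ring).
assert (Hq : Cmod (q - p) = Rabs h * Cmod z)
  by now rewrite Eq, Cmod_mult, Cmod_R.
assert (H3 : Cmod (f q - f p - b * (q - p)) <= K * Cmod (q - p) ^ 2).
{ apply H; rewrite Hq; nra. }
rewrite Hq in H3.
change (Rabs ((Re (c * f q) - Re (c * f p)) / h - Re (c * b * z)) < eps).
replace ((Re (c * f q) - Re (c * f p)) / h - Re (c * b * z))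
  with (Re (c * (f q - f p - b * (q - p))) / h).
2: { rewrite Eq; unfold Re; simpl; field; exact Hh. }
unfold Rdiv; rewrite Rabs_mult, Rabs_inv.
apply Rlt_div_l; [exact Habs|].
apply Rle_lt_trans with (1 := re_le_Cmod _); rewrite Cmod_mult.
apply Rle_lt_trans with (Cmod c * (K * (Rabs h * Cmod z) ^ 2)).
- apply Rmult_le_compat_l; assumption.
- replace (Cmod c * (K * (Rabs h * Cmod z) ^ 2)) with (Q * Rabs h * Rabs h)
    by (unfold Q; ring).
  apply Rmult_lt_compat_r; [exact Habs|lra].
Qed.

(** The inverse hyperbolic tangent, that is, the hyperbolic distance from 0. *)
Definition half_log (x : R) : R := / 2 * ln ((1 + x) / (1 - x)).

Lemma half_log_ge_0 (x : R) : 0 <= x < 1 -> 0 <= half_log x.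
Proof.
intros Hx; unfold half_log.
apply Rmult_le_pos; [lra|].
rewrite <- ln_1; apply ln_le; [lra|].
apply Rle_div_r; lra.
Qed.

(** Along the radius to z, |f'| is at most B times the derivative of the
    hyperbolic length.  With c the conjugate of f(z) - f(0), the function
    Re(c f(t z)) - |c| B L(t z) is therefore nonincreasing in t on [0, 1], and
    comparing its values at 0 and 1 gives |c|^2 <= |c| B L(z). *)
Lemma bloch_growth (f : C -> C) (B : R) (z : C) :
  analytic_on_disk f ->
  (forall w, in_disk w -> (1 - Cmod w ^ 2) * Cmod (C_derive f w) <= B) ->
  in_disk z -> Cmod (f z) <= Cmod (f (RtoC 0)) + B * half_log (Cmod z).
Proof.
intros Hf HB Hz; unfold in_disk in Hz.
assert (Hz0 := Cmod_ge_0 z).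
set (c := Cconj (f z - f (RtoC 0))).
set (k := Cmod c * B).
assert (Hc0 := Cmod_ge_0 c).
set (rho := Cmod z) in *.
assert (Hray : forall t, 0 <= t <= 1 -> Cmod (RtoC t * z)%C = t * rho).
{ intros t Ht; rewrite Cmod_mult, Cmod_R, Rabs_pos_eq; [reflexivity|lra]. }
assert (Hrayin : forall t, 0 <= t <= 1 -> in_disk (RtoC t * z)%C).
{ intros t Ht; unfold in_disk; rewrite Hray by exact Ht; nra. }
pose (phi := fun t : R =>
  Re (c * f (RtoC t * z)%C) - k * (/ 2 * (ln (1 + t * rho) - ln (1 - t * rho)))).
pose (dphi := fun t : R => Re (c * C_derive f (RtoC t * z)%C * z)
  - k * (/ 2 * (rho / (1 + t * rho) + rho / (1 - t * rho)))).
assert (Hder : forall t, 0 <= t <= 1 -> is_derive phi t (dphi t)).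
{ intros t Ht; unfold phi, dphi.
  assert (t * rho < 1) by nra; assert (0 <= t * rho) by nra.
  apply (is_derive_minus (fun t : R => Re (c * f (RtoC t * z)%C))).
  - apply is_derive_ray; apply Hf; now apply Hrayin.
  - auto_derive; [repeat split; lra|]; field; lra. }
destruct (MVT_gen phi 0 1 dphi) as [t [Ht E]].
{ rewrite Rmin_left, Rmax_right by lra; intros t Ht; apply Hder; lra. }
{ rewrite Rmin_left, Rmax_right by lra; intros t Ht.
  apply derivable_continuous_pt; exists (dphi t).
  now apply is_derive_Reals, Hder. }
rewrite Rmin_left, Rmax_right in Ht by lra.
assert (Hneg : dphi t <= 0).
{ unfold dphi; assert (Hin := HB _ (Hrayin t Ht)).
  rewrite Hray in Hin by exact Ht.
  set (D := C_derive f (RtoC t * z)%C) in *.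
  assert (0 <= t * rho < 1) by nra.
  assert (Hpos : 0 < 1 - (t * rho) ^ 2) by nra.
  assert (HR : Re (c * D * z) <= Cmod c * Cmod D * rho).
  { apply Rle_trans with (1 := Rle_abs _).
    apply Rle_trans with (1 := re_le_Cmod _); rewrite !Cmod_mult; apply Rle_refl. }
  assert (HD : Cmod D <= B / (1 - (t * rho) ^ 2)).
  { apply Rle_div_r; [exact Hpos|lra]. }
  replace (k * (/ 2 * (rho / (1 + t * rho) + rho / (1 - t * rho))))
    with (Cmod c * (B / (1 - (t * rho) ^ 2)) * rho)
    by (unfold k; field; repeat split; nra).
  assert (Cmod c * Cmod D * rho <= Cmod c * (B / (1 - (t * rho) ^ 2)) * rho).
  { apply Rmult_le_compat_r; [exact Hz0|now apply Rmult_le_compat_l]. }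
  lra. }
assert (Hle : phi 1 <= phi 0) by lra.
unfold phi in Hle.
replace (RtoC 1 * z)%C with z in Hle by ring.
replace (RtoC 0 * z)%C with (RtoC 0) in Hle by ring.
replace (1 + 0 * rho) with 1 in Hle by ring.
replace (1 - 0 * rho) with 1 in Hle by ring.
rewrite ln_1, !Rmult_1_l in Hle.
assert (Hlog : half_log rho = / 2 * (ln (1 + rho) - ln (1 - rho))).
{ unfold half_log; now rewrite ln_div by lra. }
rewrite <- Hlog in Hle.
assert (Hsq : Re (c * f z) - Re (c * f (RtoC 0)) = Cmod c * Cmod c).
{ unfold c; rewrite Cmod_conj.
  transitivity (Cmod (f z - f (RtoC 0)) ^ 2); [|ring].
  rewrite Cmod2_expand; unfold Re, Cconj; simpl; ring. }
assert (Hfin : Cmod c * Cmod c <= Cmod c * (B * half_log rho))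
  by (unfold k in Hle; lra).
assert (HB0 : 0 <= B).
{ apply Rle_trans with (2 := HB (RtoC 0) ltac:(unfold in_disk; rewrite Cmod_0; lra)).
  rewrite Cmod_0; generalize (Cmod_ge_0 (C_derive f (RtoC 0))); nra. }
assert (Hl0 := half_log_ge_0 rho (conj Hz0 Hz)).
assert (Hcle : Cmod c <= B * half_log rho).
{ destruct Hc0 as [Hc0|Hc0].
  - now apply Rmult_le_reg_l with (Cmod c).
  - rewrite <- Hc0; now apply Rmult_le_pos. }
assert (T := Cmod_triangle (f (RtoC 0)) (f z - f (RtoC 0))%C).
replace (f (RtoC 0) + (f z - f (RtoC 0)))%C with (f z) in T by ring.
unfold c in Hcle; rewrite Cmod_conj in Hcle; lra.
Qed.

(** * Suprema over the disk and the Bloch norm *)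

Lemma in_disk_0 : in_disk (RtoC 0).
Proof. unfold in_disk; rewrite Cmod_0; lra. Qed.

Lemma disk_sup_ub (u : C -> R) (z : C) :
  in_disk z -> Rbar_le (Finite (u z)) (disk_sup u).
Proof.
intros Hz; unfold disk_sup.
apply (proj1 (Lub_Rbar_correct _)); now exists z.
Qed.

Lemma disk_sup_le (u : C -> R) (l : Rbar) :
  (forall z, in_disk z -> Rbar_le (Finite (u z)) l) -> Rbar_le (disk_sup u) l.
Proof.
intros H; apply (proj2 (Lub_Rbar_correct _)).
intros x [z [Hz ->]]; now apply H.
Qed.

Lemma disk_sup_ge_0 (u : C -> R) :
  (forall z, in_disk z -> 0 <= u z) -> Rbar_le (Finite 0) (disk_sup u).
Proof.
intros H; apply Rbar_le_trans with (Finite (u (RtoC 0))).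
- exact (H _ in_disk_0).
- apply disk_sup_ub, in_disk_0.
Qed.

Lemma disk_sup_finite (u : C -> R) :
  disk_sup u <> p_infty -> exists s : R, disk_sup u = Finite s.
Proof.
generalize (disk_sup_ub u _ in_disk_0).
destruct (disk_sup u) as [s| |]; simpl; [now exists s|easy|easy].
Qed.

Lemma one_minus_Cmod2_ge_0 (z : C) : in_disk z -> 0 <= 1 - Cmod z ^ 2.
Proof. unfold in_disk; generalize (Cmod_ge_0 z); nra. Qed.

(** Turns bounds on the extended-real norm into inequalities between real
    numbers at each point of the disk. *)
Lemma bloch_norm_le_iff (f : C -> C) (x : R) :
  Rbar_le (bloch_norm f) (Finite x) <->
  forall z, in_disk z ->
    Cmod (f (RtoC 0)) + (1 - Cmod z ^ 2) * Cmod (C_derive f z) <= x.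
Proof.
unfold bloch_norm, bloch_beta.
set (u := fun z => (1 - Cmod z ^ 2) * Cmod (C_derive f z)).
split.
- intros H z Hz; assert (Hu := disk_sup_ub u z Hz).
  change (Cmod (f (RtoC 0)) + u z <= x).
  destruct (disk_sup u) as [s| |]; simpl in *; [lra|easy|easy].
- intros H.
  assert (Hs : Rbar_le (disk_sup u) (Finite (x - Cmod (f (RtoC 0))))).
  { apply disk_sup_le; intros z Hz; simpl; generalize (H z Hz); unfold u; lra. }
  destruct (disk_sup u) as [s| |]; simpl in *; [lra|easy|easy].
Qed.

Lemma bloch_finite (f : C -> C) :
  bloch f -> exists b : R, 0 <= b /\
    bloch_norm f = Finite (Cmod (f (RtoC 0)) + b) /\
    forall z, in_disk z -> (1 - Cmod z ^ 2) * Cmod (C_derive f z) <= b.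
Proof.
intros [_ Hlt]; unfold bloch_norm, bloch_beta in *.
set (u := fun z => (1 - Cmod z ^ 2) * Cmod (C_derive f z)) in *.
destruct (disk_sup_finite u) as [b Hb].
{ intros E; rewrite E in Hlt; exact Hlt. }
exists b; rewrite Hb; split; [|split].
- assert (H0 : Rbar_le (Finite 0) (disk_sup u)).
  { apply disk_sup_ge_0; intros z Hz; apply Rmult_le_pos;
      [now apply one_minus_Cmod2_ge_0|apply Cmod_ge_0]. }
  rewrite Hb in H0; exact H0.
- reflexivity.
- intros z Hz; assert (H := disk_sup_ub u z Hz); rewrite Hb in H; exact H.
Qed.

Lemma bloch_of_norm_le (f : C -> C) (x : R) :
  analytic_on_disk f -> Rbar_le (bloch_norm f) (Finite x) -> bloch f.
Proof.
intros Hf Hx; split; [exact Hf|]; unfold bloch_norm in Hx.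
now destruct (bloch_beta f).
Qed.

Lemma C_derive_const (c z : C) : C_derive (fun _ => c) z = 0%C.
Proof. exact (quad_at_C_derive _ _ _ (quad_at_const c z)). Qed.

Lemma analytic_at_scal (c : C) (f : C -> C) (z : C) :
  analytic_at f z -> analytic_at (fun w => c * f w)%C z.
Proof.
intros [a [r [Hr H]]]; exists (@PS_scal C_AbsRing C_NormedModule c a), r.
split; [exact Hr|]; intros w Hw.
apply (@is_pseries_scal C_AbsRing C_NormedModule); [apply Cmult_comm|].
now apply H.
Qed.

Lemma analytic_at_const (c z : C) : analytic_at (fun _ => c) z.
Proof.
exists (fun n => match n with O => c | S _ => 0%C end), 1; split; [lra|].
intros w _; unfold is_pseries, is_series.
apply filterlim_ext with (fun _ : nat => (c : C_NormedModule)).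
2: apply filterlim_const.
intros n; induction n as [|n IH].
- rewrite sum_O; symmetry; exact (Cmult_1_l c).
- rewrite sum_Sn, <- IH; symmetry.
  change (c + pow_n (w - z)%C (S n) * 0 = c)%C; ring.
Qed.

Lemma bloch_norm_one : Rbar_le (bloch_norm (fun _ => RtoC 1)) (Finite 1).
Proof.
apply bloch_norm_le_iff; intros z _.
rewrite C_derive_const, Cmod_1, Cmod_0; lra.
Qed.

Lemma bloch_one : bloch (fun _ => RtoC 1).
Proof.
apply bloch_of_norm_le with 1; [|exact bloch_norm_one].
intros z _; apply analytic_at_const.
Qed.

Lemma C_derive_mult (f g : C -> C) (z : C) :
  analytic_at f z -> analytic_at g z ->
  C_derive (fun w => f w * g w)%C z
  = (C_derive f z * g z + f z * C_derive g z)%C.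
Proof.
intros Hf Hg; apply quad_at_C_derive, quad_at_mult;
  now apply analytic_at_quad_derive.
Qed.

Lemma bloch_norm_scal_le (c : C) (f : C -> C) (x : R) :
  analytic_on_disk f -> Rbar_le (bloch_norm f) (Finite x) ->
  Rbar_le (bloch_norm (fun z => c * f z)%C) (Finite (Cmod c * x)).
Proof.
intros Hf Hx; apply bloch_norm_le_iff; intros z Hz.
rewrite (C_derive_mult (fun _ => c) f z (analytic_at_const c z) (Hf z Hz)).
rewrite C_derive_const, Cmult_0_l, Cplus_0_l, !Cmod_mult.
assert (H := proj1 (bloch_norm_le_iff f x) Hx z Hz).
generalize (Rmult_le_compat_l _ _ _ (Cmod_ge_0 c) H); lra.
Qed.

(** * The operator norm *)

Lemma bloch_op_norm_ub (T : (C -> C) -> (C -> C)) (f : C -> C) :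
  bloch f -> Rbar_le (bloch_norm f) (Finite 1) ->
  Rbar_le (bloch_norm (T f)) (bloch_op_norm T).
Proof.
intros Hf H1; apply (proj1 (proj2_sig (Rbar_ex_lub _))); now exists f.
Qed.

Lemma bloch_op_norm_le (T : (C -> C) -> (C -> C)) (l : Rbar) :
  (forall f, bloch f -> Rbar_le (bloch_norm f) (Finite 1) ->
     Rbar_le (bloch_norm (T f)) l) ->
  Rbar_le (bloch_op_norm T) l.
Proof.
intros H; apply (proj2 (proj2_sig (Rbar_ex_lub _))).
intros y [f [Hf [H1 ->]]]; now apply H.
Qed.

Lemma bloch_op_norm_finite (T : (C -> C) -> (C -> C)) :
  bloch_bounded_operator T ->
  exists N : R, 0 <= N /\ bloch_op_norm T = Finite N.
Proof.
intros [HT [_ [_ [M HM]]]].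
assert (Hlow := bloch_op_norm_ub T _ bloch_one bloch_norm_one).
destruct (bloch_finite _ (HT _ bloch_one)) as [b [Hb [Eb _]]].
rewrite Eb in Hlow.
assert (Hup : Rbar_le (bloch_op_norm T) (Finite (Rabs M))).
{ apply bloch_op_norm_le; intros f Hf H1.
  destruct (bloch_finite f Hf) as [x [Hx [E _]]].
  assert (H := HM f Hf); rewrite E in H, H1; simpl in H1.
  apply Rbar_le_trans with (1 := H); simpl.
  generalize (Cmod_ge_0 (f (RtoC 0))) (Rle_abs M) (Rabs_pos M); nra. }
destruct (bloch_op_norm T) as [N| |]; simpl in *; [|easy|easy].
exists N; split; [|reflexivity].
generalize (Cmod_ge_0 (T (fun _ => RtoC 1) (RtoC 0))); lra.
Qed.

(** Homogeneity extends the bound from the unit ball to all of the space.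
    Normalizing by some y > x rather than by x covers the case x = 0. *)
Lemma mult_op_norm_bound (psi f : C -> C) (N x : R) :
  bloch_bounded_operator (mult_op psi) ->
  bloch_op_norm (mult_op psi) = Finite N ->
  bloch f -> Rbar_le (bloch_norm f) (Finite x) ->
  Rbar_le (bloch_norm (mult_op psi f)) (Finite (N * x)).
Proof.
intros HT HN Hf Hx.
assert (Hgen : forall y, 0 < y -> x <= y ->
          Rbar_le (bloch_norm (mult_op psi f)) (Finite (N * y))).
{ intros y Hy Hxy.
  set (g := fun z => (RtoC (/ y) * f z)%C).
  assert (Hgn : Rbar_le (bloch_norm g) (Finite 1)).
  { replace 1 with (Cmod (RtoC (/ y)) * y).
    - apply bloch_norm_scal_le; [apply Hf|].
      now apply Rbar_le_trans with (1 := Hx).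
    - rewrite Cmod_R, Rabs_pos_eq; [field; lra|].
      now apply Rlt_le, Rinv_0_lt_compat. }
  assert (Hg : bloch g).
  { apply bloch_of_norm_le with (2 := Hgn); intros z Hz.
    apply analytic_at_scal, Hf, Hz. }
  assert (HTg := bloch_op_norm_ub (mult_op psi) g Hg Hgn).
  rewrite HN in HTg.
  replace (mult_op psi f) with (fun z => RtoC y * mult_op psi g z)%C.
  - replace (N * y) with (Cmod (RtoC y) * N).
    + apply bloch_norm_scal_le; [|exact HTg].
      apply (proj1 HT g Hg).
    + rewrite Cmod_R, Rabs_pos_eq; lra.
  - apply functional_extensionality; intros z; unfold mult_op, g.
    rewrite RtoC_inv by lra; field.
    intros E; apply RtoC_inj in E; lra. }
destruct (bloch_finite _ (proj1 HT f Hf)) as [b [Hb [E _]]].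
rewrite E in *; simpl in *.
destruct (bloch_finite f Hf) as [b' [Hb' [E' _]]].
rewrite E' in Hx; simpl in Hx.
assert (Hx0 : 0 <= x) by (generalize (Cmod_ge_0 (f (RtoC 0))); lra).
destruct (bloch_op_norm_finite _ HT) as [N' [HN0 EN]].
rewrite HN in EN; injection EN as <-.
apply le_epsilon; intros eps Heps.
assert (He : 0 < eps / (N + 1)) by (apply Rdiv_lt_0_compat; lra).
apply Rle_trans with (1 := Hgen (x + eps / (N + 1)) ltac:(lra) ltac:(lra)).
assert (N * (eps / (N + 1)) <= eps); [|lra].
apply Rle_trans with ((N + 1) * (eps / (N + 1))); [nra|].
apply Req_le; field; lra.
Qed.

Lemma bloch_eval_le (f : C -> C) (x : R) (z : C) :
  bloch f -> Rbar_le (bloch_norm f) (Finite x) -> in_disk z ->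
  Cmod (f z) <= x * (1 + half_log (Cmod z)).
Proof.
intros Hf Hx Hz; destruct (bloch_finite f Hf) as [b [Hb [E Hbd]]].
rewrite E in Hx; simpl in Hx.
apply Rle_trans with (1 := bloch_growth f b z (proj1 Hf) Hbd Hz).
assert (Hl := half_log_ge_0 (Cmod z) (conj (Cmod_ge_0 z) Hz)).
generalize (Cmod_ge_0 (f (RtoC 0))); nra.
Qed.

(** Otherwise the powers of x / N would be bounded by [K]. *)
Lemma le_of_pow_le (x N K : R) :
  0 <= N -> (forall n : nat, x ^ n <= N ^ n * K) -> x <= N.
Proof.
intros HN H; apply Rnot_lt_le; intros Hlt.
destruct HN as [HN|HN].
- assert (Hq : 1 < x / N) by (apply Rlt_div_r; lra).
  destruct (Pow_x_infinity (x / N)) with (b := K + 1) as [n Hn].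
  { rewrite Rabs_pos_eq; lra. }
  assert (Hn' := Hn n (le_n n)).
  rewrite Rabs_pos_eq in Hn' by (apply pow_le; lra).
  assert (HNn : 0 < N ^ n) by now apply pow_lt.
  assert (E : x ^ n = N ^ n * (x / N) ^ n).
  { rewrite <- Rpow_mult_distr; f_equal; field; lra. }
  generalize (H n); rewrite E; nra.
- rewrite <- HN in *; generalize (H 1%nat); simpl; lra.
Qed.

(** The power trick: the n-th power of psi has norm at most N^n, and evaluation
    at z is bounded on the Bloch space by a constant that does not depend on n. *)
Lemma sup_norm_le_op_norm (psi : C -> C) :
  bloch_bounded_operator (mult_op psi) ->
  Rbar_le (sup_norm psi) (bloch_op_norm (mult_op psi)).
Proof.
intros HT; destruct (bloch_op_norm_finite _ HT) as [N [HN0 HN]].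
rewrite HN; apply disk_sup_le; intros z Hz; simpl.
set (pw := fun n => Nat.iter n (mult_op psi) (fun _ => RtoC 1)).
assert (Hpw : forall n, bloch (pw n) /\
          Rbar_le (bloch_norm (pw n)) (Finite (N ^ n))).
{ induction n as [|n [IH1 IH2]]; [split; [exact bloch_one|exact bloch_norm_one]|].
  split; [now apply (proj1 HT)|].
  now apply mult_op_norm_bound. }
assert (Hval : forall n, Cmod (pw n z) = Cmod (psi z) ^ n).
{ induction n as [|n IH]; [exact Cmod_1|].
  change (Cmod (psi z * pw n z) = Cmod (psi z) ^ S n).
  now rewrite Cmod_mult, IH. }
apply le_of_pow_le with (1 + half_log (Cmod z)); [exact HN0|].
intros n; rewrite <- Hval; destruct (Hpw n) as [H1 H2].
now apply bloch_eval_le.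
Qed.

Lemma bloch_norm_le_op_norm (psi : C -> C) :
  bloch_bounded_operator (mult_op psi) ->
  bloch psi /\ Rbar_le (bloch_norm psi) (bloch_op_norm (mult_op psi)).
Proof.
intros HT.
assert (E : mult_op psi (fun _ => RtoC 1) = psi).
{ apply functional_extensionality; intros z; apply Cmult_1_r. }
rewrite <- E at 1 2; split.
- exact (proj1 HT _ bloch_one).
- exact (bloch_op_norm_ub _ _ bloch_one bloch_norm_one).
Qed.

(** Splitting |f(z)| by the growth estimate, the part |f(0)| of the term psi' f
    joins |psi(0) f(0)| to form the norm of psi, and the part beta_f L(z) joins
    psi f' to form the sum of [s] and [sigma].  The two weights |f(0)| and beta_f
    have sum at most 1. *)
Lemma bloch_norm_mult_le (psi f : C -> C) (p s sigma K : R) :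
  analytic_on_disk psi -> bloch f -> Rbar_le (bloch_norm f) (Finite 1) ->
  Rbar_le (bloch_norm psi) (Finite p) ->
  Rbar_le (sup_norm psi) (Finite s) ->
  Rbar_le (sigma_infty psi) (Finite sigma) ->
  p <= K -> s + sigma <= K ->
  Rbar_le (bloch_norm (mult_op psi f)) (Finite K).
Proof.
intros Hpsi Hf Hf1 Hp Hs Hsigma HpK HsK.
destruct (bloch_finite f Hf) as [b [Hb [E Hbd]]].
rewrite E in Hf1; simpl in Hf1.
apply bloch_norm_le_iff; intros z Hz.
unfold mult_op at 2; rewrite C_derive_mult by (try apply Hf; auto).
assert (Hg := bloch_growth f b z (proj1 Hf) Hbd Hz).
assert (Hbz := Hbd z Hz).
assert (Hpz := proj1 (bloch_norm_le_iff psi p) Hp z Hz).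
assert (Hsz : Cmod (psi z) <= s).
{ exact (Rbar_le_trans _ _ _ (disk_sup_ub (fun z => Cmod (psi z)) z Hz) Hs). }
assert (Hsig : (1 - Cmod z ^ 2) * Cmod (C_derive psi z) * half_log (Cmod z)
               <= sigma).
{ assert (H := Rbar_le_trans _ _ _ (disk_sup_ub (fun z => / 2 * (1 - Cmod z ^ 2)
    * Cmod (C_derive psi z) * ln ((1 + Cmod z) / (1 - Cmod z))) z Hz) Hsigma).
  simpl in H; unfold half_log; simpl; lra. }
unfold mult_op; rewrite Cmod_mult.
assert (Hw := one_minus_Cmod2_ge_0 z Hz); set (w := 1 - Cmod z ^ 2) in *.
set (L := half_log (Cmod z)) in *.
set (f0 := Cmod (f (RtoC 0))) in *; set (p0 := Cmod (psi (RtoC 0))) in *.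
assert (Hf0 : 0 <= f0) by apply Cmod_ge_0.
assert (T := Cmod_triangle (C_derive psi z * f z) (psi z * C_derive f z)).
rewrite !Cmod_mult in T.
set (dp := Cmod (C_derive psi z)) in *; set (df := Cmod (C_derive f z)) in *.
assert (Hdp : 0 <= dp) by apply Cmod_ge_0.
assert (Hdf : 0 <= df) by apply Cmod_ge_0.
assert (Hpz0 := Cmod_ge_0 (psi z)).
apply Rle_trans with (p0 * f0 + (w * dp * (f0 + b * L) + Cmod (psi z) * (w * df))).
- apply Rplus_le_compat_l.
  apply Rle_trans with (1 := Rmult_le_compat_l _ _ _ Hw T).
  assert (w * dp * Cmod (f z) <= w * dp * (f0 + b * L)).
  { apply Rmult_le_compat_l; [now apply Rmult_le_pos|exact Hg]. }
  lra.
- assert (H1 : Cmod (psi z) * (w * df) <= s * b).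
  { apply Rmult_le_compat; [exact Hpz0|now apply Rmult_le_pos|assumption..]. }
  assert (H2 : (p0 + w * dp) * f0 <= K * f0).
  { apply Rmult_le_compat_r; [exact Hf0|lra]. }
  assert (H3 : (w * dp * L + s) * b <= K * b).
  { apply Rmult_le_compat_r; [exact Hb|lra]. }
  assert (HK : 0 <= K).
  { apply Rle_trans with (2 := HpK), Rle_trans with (2 := Hpz).
    apply Rplus_le_le_0_compat; [apply Cmod_ge_0|now apply Rmult_le_pos]. }
  assert (K * (f0 + b) <= K * 1) by now apply Rmult_le_compat_l.
  lra.
Qed.

Lemma Rbar_max_lub (x y l : Rbar) :
  Rbar_le x l -> Rbar_le y l -> Rbar_le (Rbar_max x y) l.
Proof. intros Hx Hy; unfold Rbar_max; now destruct (Rbar_le_dec x y). Qed.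

Lemma Rbar_max_ge_l (x y : Rbar) : Rbar_le x (Rbar_max x y).
Proof.
unfold Rbar_max; destruct (Rbar_le_dec x y); [assumption|apply Rbar_le_refl].
Qed.

Lemma Rbar_max_ge_r (x y : Rbar) : Rbar_le y (Rbar_max x y).
Proof.
unfold Rbar_max; destruct (Rbar_le_dec x y); [apply Rbar_le_refl|].
now apply Rbar_lt_le, Rbar_not_le_lt.
Qed.

Lemma sigma_infty_ge_0 (psi : C -> C) : Rbar_le (Finite 0) (sigma_infty psi).
Proof.
apply disk_sup_ge_0; intros z Hz.
replace (/ 2 * (1 - Cmod z ^ 2) * Cmod (C_derive psi z)
         * ln ((1 + Cmod z) / (1 - Cmod z)))
  with ((1 - Cmod z ^ 2) * Cmod (C_derive psi z) * half_log (Cmod z))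
  by (unfold half_log; ring).
apply Rmult_le_pos; [apply Rmult_le_pos|].
- now apply one_minus_Cmod2_ge_0.
- apply Cmod_ge_0.
- apply half_log_ge_0; split; [apply Cmod_ge_0|exact Hz].
Qed.

(** The supremum of psi is finite by [sup_norm_le_op_norm], so the right-hand
    side can be infinite only through sigma, in which case the bound is void. *)
Lemma op_norm_upper (psi : C -> C) :
  analytic_on_disk psi -> bloch_bounded_operator (mult_op psi) ->
  Rbar_le (bloch_op_norm (mult_op psi))
    (Rbar_max (bloch_norm psi) (Rbar_plus (sup_norm psi) (sigma_infty psi))).
Proof.
intros Hpsi HT.
destruct (bloch_norm_le_op_norm psi HT) as [HB _].
destruct (bloch_finite psi HB) as [b [_ [Ep _]]].
set (p := Cmod (psi (RtoC 0)) + b) in *.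
assert (HS := sup_norm_le_op_norm psi HT).
destruct (bloch_op_norm_finite _ HT) as [N [_ HN]].
destruct (disk_sup_finite (fun z => Cmod (psi z))) as [s Es].
{ intros E; unfold sup_norm in HS; rewrite E, HN in HS; exact HS. }
change (sup_norm psi = Finite s) in Es.
assert (Hmax1 := Rbar_max_ge_l (bloch_norm psi)
                   (Rbar_plus (sup_norm psi) (sigma_infty psi))).
assert (Hmax2 := Rbar_max_ge_r (bloch_norm psi)
                   (Rbar_plus (sup_norm psi) (sigma_infty psi))).
destruct (Rbar_max _ _) as [K| |] eqn:EK.
- assert (Hsg := sigma_infty_ge_0 psi).
  destruct (sigma_infty psi) as [sg| |] eqn:Esg; rewrite Es in Hmax2;
    simpl in Hmax2; [|easy|easy].
  rewrite Ep in Hmax1; simpl in Hmax1.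
  apply bloch_op_norm_le; intros f Hf Hf1.
  apply bloch_norm_mult_le with p s sg; try assumption.
  + rewrite Ep; apply Rbar_le_refl.
  + rewrite Es; apply Rbar_le_refl.
  + rewrite Esg; apply Rbar_le_refl.
- rewrite HN; exact I.
- rewrite Ep in Hmax1; easy.
Qed.

(** Schwarz-Pick bounds the seminorm by the supremum, and psi(0) = 0 makes the
    norm equal to the seminorm. *)
Lemma bloch_norm_le_sup_norm (psi : C -> C) :
  analytic_on_disk psi -> psi (RtoC 0) = RtoC 0 ->
  Rbar_le (bloch_norm psi) (sup_norm psi).
Proof.
intros Hpsi H0.
assert (Hub : forall z, in_disk z -> Rbar_le (Cmod (psi z)) (sup_norm psi))
  by exact (disk_sup_ub (fun z => Cmod (psi z))).
destruct (sup_norm psi) as [s| |].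
- apply bloch_norm_le_iff; intros z Hz.
  rewrite H0, Cmod_0, Rplus_0_l.
  now apply schwarz_pick.
- now destruct (bloch_norm psi).
- exfalso; exact (Hub _ in_disk_0).
Qed.

Theorem corollary2p5 (psi : C -> C)
  (hpsi : analytic_on_disk psi)
  (hbdd : bloch_bounded_operator (mult_op psi)) :
  (Rbar_le (Rbar_max (bloch_norm psi) (sup_norm psi))
           (bloch_op_norm (mult_op psi)) /\
   Rbar_le (bloch_op_norm (mult_op psi))
           (Rbar_max (bloch_norm psi)
                     (Rbar_plus (sup_norm psi) (sigma_infty psi)))) /\
  (psi (RtoC 0) = RtoC 0 ->
   Rbar_le (sup_norm psi) (bloch_op_norm (mult_op psi)) /\
   Rbar_le (bloch_op_norm (mult_op psi))
           (Rbar_plus (sup_norm psi) (sigma_infty psi))).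
Proof.
assert (Hsup := sup_norm_le_op_norm psi hbdd).
assert (Hupper := op_norm_upper psi hpsi hbdd).
split; [split|intros H0; split]; try assumption.
- apply Rbar_max_lub; [apply (bloch_norm_le_op_norm psi hbdd)|exact Hsup].
- apply Rbar_le_trans with (1 := Hupper).
  apply Rbar_max_lub; [|apply Rbar_le_refl].
  apply Rbar_le_trans with (1 := bloch_norm_le_sup_norm psi hpsi H0).
  assert (Hsg := sigma_infty_ge_0 psi).
  destruct (bloch_op_norm_finite _ hbdd) as [N [_ HN]]; rewrite HN in Hsup.
  destruct (sup_norm psi) as [s| |], (sigma_infty psi) as [sg| |];
    simpl in *; try easy; lra.
Qed.
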